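(* Let $d\ge1$, $0<t_{\max}\le+\infty$, and let $S(t,x)$ be a Divergence-free symmetric $(1+d)\times(1+d)$ tensor over $(0,t_{\max})\times\mathbb{R}^d$, with distributional entries, written blockwise $$S=\begin{pmatrix}\rho&m^T\\ m&T\end{pmatrix},$$ where $\rho$ is scalar, $m$ is $\mathbb{R}^d$-valued and $T$ is $d\times d$ and symmetric. Let $\alpha$ be a positive constant and consider the change of variables $$s=\frac t{1+t\alpha},\qquad y=\frac x{1+t\alpha}.$$ Then the symmetric tensor $$\bar S=\begin{pmatrix}\bar\rho&\bar m^T\\ \bar m&\bar T\end{pmatrix},$$ whose blocks, viewed in the variables $(s,y)$, are defined by \begin{align*} \bar\rho&=(1+t\alpha)^d\rho,\\ \bar m&=(1+t\alpha)^{d+1}m-\alpha(1+t\alpha)^d\rho\,x,\\ \bar T&=(1+t\alpha)^{d+2}T-\alpha(1+t\alpha)^{d+1}(m\otimes x+x\otimes m)+\alpha^2(1+t\alpha)^d\rho\,x\otimes x, \end{align*} is Divergence-free in the $(s,y)$ variables: $\mathrm{Div}_{s,y}\bar S=0$.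
   Context: A tensor is a matrix-valued map (here with distributional entries). Its divergence $\mathrm{Div}$ is taken row-wise: $(\mathrm{Div}_{t,x}S)_i=\partial_ts_{i0}+\sum_{j=1}^d\partial_{x_j}s_{ij}$ for $i=0,\dots,d$; $S$ is Divergence-free if $\mathrm{Div}\,S=0$. For vectors $u,v$, $u\otimes v=uv^T$. The map $(t,x)\mapsto(s,y)$ is a diffeomorphism from $(0,t_{\max})\times\mathbb{R}^d$ onto $(0,\tau)\times\mathbb{R}^d$ with $\tau=t_{\max}/(1+\alpha t_{\max})$ ($\tau=1/\alpha$ if $t_{\max}=+\infty$), and $1+t\alpha=(1-s\alpha)^{-1}$; distributions are transported from $(t,x)$ to $(s,y)$ by composition with this diffeomorphism. *)

(* Defs.v *)
From HB Require Import structures.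
From mathcomp Require Import all_boot all_order all_algebra.
From mathcomp Require Import all_classical all_reals all_analysis.

Set Implicit Arguments.
Unset Strict Implicit.
Unset Printing Implicit Defensive.

Import Order.TTheory GRing.Theory Num.Theory.
Import numFieldNormedType.Exports.

Local Open Scope classical_set_scope.
Local Open Scope ring_scope.

(* Distributions on an open set of R^n.  A distribution is represented by a
   functional on all functions R^n -> R, of which only the values on test
   functions are meaningful: two distributions on Omega are identified when
   they agree on the test functions of Omega. *)

Notation functional R n := (('rV[R]_n -> R) -> R) (only parsing).

Section Distributions.
Variables (R : realType) (n : nat).
Implicit Types (f phi psi g : 'rV[R]_n -> R) (u : functional R n).
Implicit Types (Omega K : set 'rV[R]_n).

Definition partial (i : 'I_n) f : 'rV[R]_n -> R := 'D_(delta_mx 0 i) f.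

Definition partials (s : seq 'I_n) f : 'rV[R]_n -> R := foldr partial f s.

Definition smooth f : Prop :=
  forall s : seq 'I_n, continuous (partials s f) /\
    forall i x, derivable (partials s f) x (delta_mx 0 i).

Definition supp f : set 'rV[R]_n := closure [set x | f x != 0].

Definition test_function Omega phi : Prop :=
  [/\ smooth phi, compact (supp phi) & supp phi `<=` Omega].

(* Sum of the sup norms of all derivatives of order at most N; a multi-index
   is listed once for each ordering of its differentiations, which only
   changes constants in the continuity estimate below. *)
Definition seminorm (N : nat) phi : R :=
  \sum_(k < N.+1) \sum_(s : k.-tuple 'I_n)
    sup (range (fun x => `|partials s phi x|)).

Definition is_distribution Omega u : Prop :=
  (forall (a : R) phi psi,
     test_function Omega phi -> test_function Omega psi ->
     u (fun x => a * phi x + psi x) = a * u phi + u psi) /\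
  (forall K, compact K -> K `<=` Omega ->
     exists (C : R) (N : nat), forall phi,
       test_function Omega phi -> supp phi `<=` K ->
       `|u phi| <= C * seminorm N phi).

Definition dist_partial (i : 'I_n) u : functional R n :=
  fun phi => - u (partial i phi).

Definition dist_mul g u : functional R n :=
  fun phi => u (fun x => g x * phi x).

(* For a diffeomorphism Phi from Omega onto Omega', the distribution
   u o Phi^-1 on Omega'; for u a locally integrable function this is the
   change of variables formula for the integral of (u o Phi^-1) * phi over
   Omega'.  The function phi o Phi is extended by 0 outside Omega, where Phi
   has no meaning. *)
Definition dist_transport Omega (Phi : 'rV[R]_n -> 'rV[R]_n) u :
    functional R n :=
  fun phi => u (fun z =>
    if z \in Omega then `|\det ('J Phi z)| * phi (Phi z) else 0).

Definition Div (S : 'M[functional R n]_n) : 'cV[functional R n]_n :=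
  \col_i \sum_j dist_partial j (S i j).

Definition distributional Omega (S : 'M[functional R n]_n) : Prop :=
  forall i j, is_distribution Omega (S i j).

Definition symmetric_tensor Omega (S : 'M[functional R n]_n) : Prop :=
  forall i j phi, test_function Omega phi -> S i j phi = S j i phi.

Definition Div_free Omega (S : 'M[functional R n]_n) : Prop :=
  forall i phi, test_function Omega phi -> Div S i 0 phi = 0.

End Distributions.

(* Space-time R^(1+d): the coordinate of index 0 is the time t, the d others
   are the space variable x. *)
Section SpaceTime.
Variables (R : realType) (d : nat).
Implicit Types z : 'rV[R]_(1 + d).

Definition time z : R := z 0 (lshift d 0).

Definition space (j : 'I_d) z : R := z 0 (rshift 1 j).

(* (0, tmax) x R^d *)
Definition slab (tmax : \bar R) : set 'rV[R]_(1 + d) :=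
  [set z | 0 < time z /\ ((time z)%:E < tmax)%E].

Definition tensor (rho : functional R (1 + d))
    (m : 'cV[functional R (1 + d)]_d) (T : 'M[functional R (1 + d)]_d) :
    'M[functional R (1 + d)]_(1 + d) :=
  block_mx (const_mx rho) m^T m T.

Variable alpha : R.

Definition weight z : R := 1 + time z * alpha.

(* (t, x) |-> (s, y) = (t / (1 + t alpha), x / (1 + t alpha)) *)
Definition change z : 'rV[R]_(1 + d) := (weight z)^-1 *: z.

Definition tau (tmax : \bar R) : \bar R :=
  if tmax is r%:E then (r / (1 + alpha * r))%:E else (alpha^-1)%:E.

Variables (rho : functional R (1 + d)).
Variables (m : 'cV[functional R (1 + d)]_d).
Variables (T : 'M[functional R (1 + d)]_d).

Definition rho_bar : functional R (1 + d) :=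
  dist_mul (fun z => weight z ^+ d) rho.

Definition m_bar : 'cV[functional R (1 + d)]_d :=
  \col_i (dist_mul (fun z => weight z ^+ d.+1) (m i 0)
          - dist_mul (fun z => alpha * weight z ^+ d * space i z) rho).

Definition T_bar : 'M[functional R (1 + d)]_d :=
  \matrix_(i, j)
    (dist_mul (fun z => weight z ^+ d.+2) (T i j)
     - dist_mul (fun z => alpha * weight z ^+ d.+1)
         (dist_mul (space j) (m i 0) + dist_mul (space i) (m j 0))
     + dist_mul (fun z => alpha ^+ 2 * weight z ^+ d * (space i z * space j z))
         rho).

(* The tensor with blocks rho_bar, m_bar, T_bar, viewed in the variables
   (s, y). *)
Definition tensor_bar (tmax : \bar R) : 'M[functional R (1 + d)]_(1 + d) :=
  map_mx (dist_transport (slab tmax) change) (tensor rho_bar m_bar T_bar).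

End SpaceTime.

(* Main.v *)
(* Let Q phi = phi o Phi be the pullback of a test function by the change of
   variables Phi, and a(y) = 1 - alpha s = 1 / (1 + t alpha).  Since
   |det DPhi| = (1 + t alpha)^-(d+2), all the powers of the weight in the
   definition of S_bar turn into polynomials in (s, y): the entries of S_bar
   tested against phi are combinations of those of S tested against Q (p phi)
   with p among a^2, a, a y_i, 1, y_i, y_i y_j.  On the other hand
     d_l (Q phi) = Q (a (d_l phi - alpha [l = 0] sum_k y_k d_k phi)),
   so that Q maps test functions to test functions, continuously.
   The balance of mass for S_bar tested against phi is that of S tested
   against Q phi; the i-th balance of momentum for S_bar is that of S tested
   against (1 + t alpha) Q phi, minus alpha times the balance of mass of S
   tested against x_i Q phi. *)
Require Import Defs.
From HB Require Import structures.
From mathcomp Require Import all_boot all_order all_algebra.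
From mathcomp Require Import all_classical all_reals all_analysis.
From mathcomp Require Import ring lra.

Import Order.TTheory GRing.Theory Num.Theory.
Import numFieldNormedType.Exports.

Local Open Scope classical_set_scope.
Local Open Scope ring_scope.

(** * Calculus of smooth functions *)

Section SmoothFunctions.
#[local] Set Implicit Arguments.
#[local] Unset Strict Implicit.
Variables (R : realType) (n : nat).
Implicit Types (f g phi psi : 'rV[R]_n -> R) (K Omega : set 'rV[R]_n).
Implicit Types (s : seq 'I_n) (i k : 'I_n).

Lemma partials_rcons s i f : partials (rcons s i) f = partials s (partial i f).
Proof. by rewrite /partials foldr_rcons. Qed.

Lemma smooth_continuous f : smooth f -> continuous f.
Proof. by move=> /(_ [::])[]. Qed.
Arguments smooth_continuous {f} sf x : rename.

Lemma smooth_derivable f : smooth f ->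
  forall i x, derivable f x (delta_mx 0 i).
Proof. by move=> /(_ [::])[_]. Qed.
Arguments smooth_derivable {f} sf i x : rename.

Lemma smooth_partial i f : smooth f -> smooth (partial i f).
Proof. by move=> sf s; rewrite -partials_rcons. Qed.

Lemma smooth_partials s f : smooth f -> smooth (partials s f).
Proof. by move=> sf; elim: s => [|i s IH]; [exact: sf|exact: smooth_partial IH]. Qed.

Lemma is_derive_linear (a : R) f g x v : derivable f x v -> derivable g x v ->
  is_derive x v (fun x => a * f x + g x) (a * 'D_v f x + 'D_v g x).
Proof.
move=> df dg.
have := is_deriveD (is_deriveZ a (derivableP df)) (derivableP dg).
by [].
Qed.

Lemma partial_linear i (a : R) f g : smooth f -> smooth g ->
  partial i (fun x => a * f x + g x) =
  (fun x => a * partial i f x + partial i g x).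
Proof.
move=> sf sg; apply/funext => x.
by have [] := is_derive_linear a (smooth_derivable sf i x) (smooth_derivable sg i x).
Qed.

Lemma partials_linear s (a : R) f g : smooth f -> smooth g ->
  partials s (fun x => a * f x + g x) =
  (fun x => a * partials s f x + partials s g x).
Proof.
move=> sf sg; elim: s => [|i s /= ->]; first by [].
by rewrite (partial_linear i a (smooth_partials s sf) (smooth_partials s sg)).
Qed.

Lemma smooth_linear (a : R) f g : smooth f -> smooth g ->
  smooth (fun x => a * f x + g x).
Proof.
move=> sf sg s; rewrite partials_linear//; split=> [x|i x].
  exact: cvgD (cvgM (cvg_cst a) ((sf s).1 x)) ((sg s).1 x).
by have [df _] := is_derive_linear a ((sf s).2 i x) ((sg s).2 i x); exact: df.
Qed.

Lemma partials_cst s (a : R) : partials s (cst a : 'rV[R]_n -> R) =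
  cst (if s is [::] then a else 0).
Proof.
elim: s => [//|i s /= ->]; apply/funext => x; exact: derive_cst.
Qed.

Lemma smooth_cst (a : R) : smooth (cst a : 'rV[R]_n -> R).
Proof.
move=> s; rewrite partials_cst.
by split=> [x|i x]; [exact: cst_continuous|exact: derivable_cst].
Qed.

Lemma is_derive_coord (x : 'rV[R]_n) k i :
  is_derive x (delta_mx 0 i) (fun y : 'rV[R]_n => y 0 k) ((k == i)%:R : R).
Proof.
suff h : (fun h : R => h^-1 *: ((h *: delta_mx 0 i + x) 0 k - x 0 k)) @ 0^'
    --> ((k == i)%:R : R).
  by apply: DeriveDef; [apply/cvg_ex; exists (k == i)%:R|exact/cvg_lim].
apply: cvg_near_cst; near=> h.
rewrite !mxE eqxx/= addrK scalerA mulVf ?scale1r//.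
by near: h; exact: nbhs_dnbhs_neq.
Unshelve. all: by end_near. Qed.

Lemma is_derive_mulcoord k i f x : smooth f ->
  is_derive x (delta_mx 0 i) (fun y => y 0 k * f y)
    ((k == i)%:R * f x + x 0 k * partial i f x).
Proof.
move=> sf; have /derivableP df := smooth_derivable sf i x.
apply: is_derive_eq (is_deriveM (is_derive_coord x k i) df) _.
by rewrite addrC [f x *: _]mulrC.
Qed.

Lemma partial_mulcoord k i f : smooth f ->
  partial i (fun y => y 0 k * f y) =
  (fun x => (k == i)%:R * f x + x 0 k * partial i f x).
Proof.
by move=> sf; apply/funext => x; have [_ h] := is_derive_mulcoord k i x sf; exact: h.
Qed.

(** In Leibniz's rule with a linear factor, the remainder sums the derivatives of [f] in which one
    occurrence of [k] in [s] is dropped. Its smoothness is all that the induction uses, so it stays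
    existential. *)
Lemma partials_mulcoord k s f : smooth f ->
  exists2 g, smooth g &
    partials s (fun y => y 0 k * f y) = (fun x => x 0 k * partials s f x + g x).
Proof.
move=> sf; elim: s => [|i s [g sg IH]] /=.
  by exists (cst 0); [exact: smooth_cst 0|apply/funext => x; rewrite addr0].
have sfs := smooth_partials s sf.
exists (fun x => (k == i)%:R * partials s f x + partial i g x).
  exact: smooth_linear sfs (smooth_partial i sg).
rewrite IH; apply/funext => x; apply: derive_val.
have /derivableP dg := smooth_derivable sg i x.
apply: is_derive_eq (is_deriveD (is_derive_mulcoord k i x sfs) dg) _.
by rewrite -addrA addrCA.
Qed.

Lemma smooth_mulcoord k f : smooth f -> smooth (fun y => y 0 k * f y).
Proof.
move=> sf s; have [g sg ->] := partials_mulcoord k s sf.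
have sfs := smooth_partials s sf.
split=> [x|i x].
  have ck : (fun y : 'rV[R]_n => y 0 k) @ x --> x 0 k by exact: coord_continuous.
  have cf := smooth_continuous sfs x; have cg := smooth_continuous sg x.
  have ckf : (fun y : 'rV[R]_n => y 0 k * partials s f y) @ x --> x 0 k * partials s f x.
    exact: cvgM ck cf.
  exact: cvgD ckf cg.
have /derivableP dg := smooth_derivable sg i x.
by have [dh _] := is_deriveD (is_derive_mulcoord k i x sfs) dg; exact: dh.
Qed.

(** * Supports and test functions *)

Lemma supp_eq0 f x : ~ supp f x -> f x = 0.
Proof. by move=> nf; apply/eqP/negP => /negP fx; apply/nf/subset_closure. Qed.

Lemma supp_subset K f : closed K -> (forall x, ~ K x -> f x = 0) ->
  supp f `<=` K.
Proof.
move=> /closure_id cK Kf; rewrite cK; apply: closureS => x /= /eqP fx.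
by apply: contrapT => nK; exact: fx (Kf _ nK).
Qed.

Lemma compact_rV_closed K : compact K -> closed K.
Proof. by apply: compact_closed; exact: norm_hausdorff. Qed.

Lemma test_function_eq0 K f x : test_function K f -> ~ K x -> f x = 0.
Proof. by move=> [_ _ fK] Kx; apply: supp_eq0 => /fK. Qed.

(** [test_function] is also used with a compact set [K] in place of the open one; it then stands for
    the smooth functions supported in [K]. *)
Lemma test_function_intro K f : compact K -> smooth f ->
  (forall x, ~ K x -> f x = 0) -> test_function K f.
Proof.
move=> cK sf Kf; have sK := supp_subset (compact_rV_closed cK) Kf.
split=> //; apply: subclosed_compact cK sK; exact: closed_closure.
Qed.

(** Brings a test function of an open set within reach of operators defined on compact sets, its own
    support being the compact set. *)
Lemma test_function_supp Omega f :
  test_function Omega f -> test_function (supp f) f.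
Proof. by move=> [sf cf _]; split. Qed.

Lemma test_functionW K Omega f : K `<=` Omega ->
  test_function K f -> test_function Omega f.
Proof. by move=> KO [sf cf fK]; split=> //; exact: subset_trans KO. Qed.

Lemma partial_eq0 i K f x : closed K -> (forall x, ~ K x -> f x = 0) ->
  ~ K x -> partial i f x = 0.
Proof.
move=> cK Kf Kx; rewrite /partial -(derive_cst (0 : R) x (delta_mx 0 i)).
apply: near_eq_derive; near=> y; apply: Kf.
by near: y; apply: (open_nbhs_nbhs (conj _ Kx)); exact: closed_openC.
Unshelve. all: by end_near. Qed.

Lemma partials_eq0 s K f x : closed K -> (forall x, ~ K x -> f x = 0) ->
  ~ K x -> partials s f x = 0.
Proof.
move=> cK Kf; elim: s x => [|i s IH] x /=; first exact: Kf.
exact: partial_eq0.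
Qed.

Lemma test_function_linear Omega (a : R) phi psi :
  test_function Omega phi -> test_function Omega psi ->
  test_function Omega (fun x => a * phi x + psi x).
Proof.
move=> tp tq; have [sp cp pO] := tp; have [sq cq qO] := tq.
apply: (@test_functionW (supp phi `|` supp psi)).
  by move=> x [/pO|/qO].
apply: test_function_intro; [exact: compactU|exact: smooth_linear|].
move=> x /not_orP[px qx]; rewrite !supp_eq0//; ring.
Qed.

Lemma test_function0 Omega : test_function Omega (cst 0).
Proof.
apply: (@test_functionW set0) => //.
by apply: test_function_intro; [exact: compact0|exact: smooth_cst 0|].
Qed.

Lemma test_functionZ Omega (a : R) phi : test_function Omega phi ->
  test_function Omega (fun x => a * phi x).
Proof.
move=> /test_function_linear => /(_ a _ (test_function0 Omega)).
by under eq_fun do rewrite addr0.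
Qed.

Lemma test_functionD Omega phi psi :
  test_function Omega phi -> test_function Omega psi ->
  test_function Omega (fun x => phi x + psi x).
Proof.
move=> tp tq; have := test_function_linear 1 tp tq.
by under eq_fun do rewrite mul1r.
Qed.

(** * Seminorm estimates *)

Lemma sum_tuple_ge (N : nat) (F : seq 'I_n -> R) s : (forall t, 0 <= F t) ->
  (size s <= N)%N -> F s <= \sum_(k < N.+1) \sum_(t : k.-tuple 'I_n) F t.
Proof.
move=> F0 sN.
rewrite (bigD1 (Ordinal (sN : (size s < N.+1)%N)))//= (bigD1 (in_tuple s))//=.
rewrite -addrA lerDl addr_ge0 ?sumr_ge0// => i _.
exact: sumr_ge0.
Qed.

Lemma sup_partials_ge0 s phi : 0 <= sup (range (fun x => `|partials s phi x|)).
Proof.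
(* A set without a supremum has [sup] 0 by convention; otherwise [sup] is at least the value at the
   origin, an absolute value. *)
have [hs|/sup_out-> //] := pselect (has_sup (range (fun x => `|partials s phi x|))).
apply: (@le_trans _ _ `|partials s phi 0|) => //.
by apply: sup_upper_bound => //; exists 0.
Qed.

Lemma seminorm_ge0 N phi : 0 <= seminorm N phi.
Proof.
by apply: sumr_ge0 => k _; apply: sumr_ge0 => s _; exact: sup_partials_ge0.
Qed.

(** Compactness makes the suprema genuine: a derivative is continuous, hence bounded on [K], and it
    vanishes off [K]. *)
Lemma partials_le_seminorm K N s phi x : compact K -> test_function K phi ->
  (size s <= N)%N -> `|partials s phi x| <= seminorm N phi.
Proof.
move=> cK tp sN; pose F t := sup (range (fun x => `|partials t phi x|)).
apply: le_trans (@sum_tuple_ge N F s _ sN); last first.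
  by move=> t; exact: sup_partials_ge0.
have [sp _ _] := tp.
apply: sup_upper_bound; last by exists x.
split; first by exists `|partials s phi x|, x.
have cf : continuous (partials s phi) by exact: (sp s).1.
have /compact_bounded[M [_ /(_ (M + 1))]] : compact (partials s phi @` K).
  by apply: continuous_compact => //; exact: continuous_subspaceT.
rewrite ltrDl ltr01 => /(_ isT) HM.
exists (Num.max (M + 1) 0) => _ [y _ <-]; rewrite le_max.
have [Ky|nKy] := pselect (K y); first by rewrite HM//; exists y.
rewrite (@partials_eq0 s K) ?normr0 ?lexx ?orbT//.
  exact: compact_rV_closed.
by move=> z; exact: test_function_eq0 tp.
Qed.

Definition seminorm_terms N : R := \sum_(k < N.+1) \sum_(s : k.-tuple 'I_n) 1.

Lemma seminorm_terms_ge0 N : 0 <= seminorm_terms N.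
Proof. by apply: sumr_ge0 => k _; exact: sumr_ge0. Qed.

(** Converse of [partials_le_seminorm], at the cost of the number of terms of the sum. Together they
    compare seminorms of different orders. *)
Lemma seminorm_le N phi M :
  (forall s x, (size s <= N)%N -> `|partials s phi x| <= M) ->
  seminorm N phi <= seminorm_terms N * M.
Proof.
move=> H; rewrite /seminorm_terms mulr_suml; apply: ler_sum => k _.
rewrite mulr_suml; apply: ler_sum => s _; rewrite mul1r.
apply: ge_sup; first by exists `|partials s phi 0|, 0.
by move=> _ [x _ <-]; apply: H; rewrite size_tuple -ltnS.
Qed.

(** * Continuous operators on test functions *)

Definition seminorm_bounded K (A : ('rV[R]_n -> R) -> 'rV[R]_n -> R) :=
  exists C N, 0 <= C /\
    forall phi, test_function K phi -> forall x, `|A phi x| <= C * seminorm N phi.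

(** For a linear operator this is continuity between the Frechet spaces of smooth functions
    supported in [K] and in [K']. *)
Definition continuous_op K K' (A : ('rV[R]_n -> R) -> 'rV[R]_n -> R) :=
  (forall phi, test_function K phi -> test_function K' (A phi)) /\
  forall N, exists C N', 0 <= C /\
    forall phi, test_function K phi -> seminorm N (A phi) <= C * seminorm N' phi.

(** Finitely many index lists have length at most [N], so the bounds on separate derivatives merge
    into one, with the largest order and the sum of the constants. *)
Lemma continuous_op_intro K K' A : compact K ->
  (forall phi, test_function K phi -> test_function K' (A phi)) ->
  (forall s, seminorm_bounded K (fun phi => partials s (A phi))) ->
  continuous_op K K' A.
Proof.
move=> cK tA bA; split=> // N.
have /choice[C_ /choice[N_ CN]] := bA.
pose N' := (\max_(k < N.+1) \max_(s : k.-tuple 'I_n) N_ s)%N.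
(* [F s] includes the price of raising the order from [N_ s] to [N']. *)
pose F s := C_ s * seminorm_terms (N_ s).
have F0 s : 0 <= F s by rewrite mulr_ge0 ?seminorm_terms_ge0//; case: (CN s).
exists (seminorm_terms N * \sum_(k < N.+1) \sum_(s : k.-tuple 'I_n) F s), N'.
split=> [|phi tp].
  rewrite mulr_ge0 ?seminorm_terms_ge0//.
  by apply: sumr_ge0 => k _; exact: sumr_ge0.
rewrite -mulrA; apply: seminorm_le => s x sN.
have [Cs0 /(_ phi tp x) /le_trans] := CN s; apply.
apply: (@le_trans _ _ (F s * seminorm N' phi)); last first.
  by rewrite ler_wpM2r ?seminorm_ge0//; exact: sum_tuple_ge.
rewrite -mulrA ler_wpM2l//; apply: seminorm_le => t y tN.
apply: partials_le_seminorm cK tp _; apply: (leq_trans tN).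
apply: leq_trans (leq_bigmax (Ordinal (sN : (size s < N.+1)%N))).
exact: (@leq_bigmax _ (fun t : (size s).-tuple 'I_n => N_ t) (in_tuple s)).
Qed.

Lemma seminorm_bounded_comp K K' A B : continuous_op K K' A ->
  seminorm_bounded K' B -> seminorm_bounded K (B \o A).
Proof.
move=> [tA bA] [C [N [C0 CN]]]; have [C' [N' [C'0 CN']]] := bA N.
exists (C * C'), N'; split=> [|phi tp x]; first exact: mulr_ge0.
rewrite -mulrA; apply: le_trans (CN _ (tA _ tp) x) _.
by rewrite ler_wpM2l// CN'.
Qed.

Lemma continuous_op_comp K K' K'' A B : continuous_op K K' A ->
  continuous_op K' K'' B -> continuous_op K K'' (B \o A).
Proof.
move=> [tA bA] [tB bB]; split=> [phi /tA/tB//|N].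
have [C [N' [C0 CN]]] := bB N; have [C' [N'' [C'0 CN']]] := bA N'.
exists (C * C'), N''; split=> [|phi tp]; first exact: mulr_ge0.
rewrite -mulrA; apply: le_trans (CN _ (tA _ tp)) _.
by rewrite ler_wpM2l// CN'.
Qed.

Lemma seminorm_bounded_partials K s : compact K ->
  seminorm_bounded K (partials s).
Proof.
move=> cK; exists 1, (size s); split=> // phi tp x.
by rewrite mul1r; exact: partials_le_seminorm tp _.
Qed.

Lemma continuous_op_bounded K K' A s : compact K' -> continuous_op K K' A ->
  seminorm_bounded K (fun phi => partials s (A phi)).
Proof.
by move=> cK' cA; exact: seminorm_bounded_comp cA (seminorm_bounded_partials s cK').
Qed.

Lemma seminorm_bounded_linear K (a : R) A B : compact K ->
  seminorm_bounded K A -> seminorm_bounded K B ->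
  seminorm_bounded K (fun phi x => a * A phi x + B phi x).
Proof.
move=> cK [C [N [C0 CN]]] [C' [N' [C'0 CN']]].
pose M := maxn N N'.
exists (`|a| * C * seminorm_terms N + C' * seminorm_terms N'), M.
split=> [|phi tp x].
  by rewrite addr_ge0// !mulr_ge0// seminorm_terms_ge0.
apply: le_trans (ler_normD _ _) _; rewrite normrM mulrDl lerD//.
  rewrite -!mulrA ler_wpM2l//; apply: le_trans (CN _ tp x) _.
  rewrite ler_wpM2l//; apply: seminorm_le => s y sN.
  by apply: partials_le_seminorm cK tp _; rewrite leq_max sN.
rewrite -!mulrA; apply: le_trans (CN' _ tp x) _.
rewrite ler_wpM2l//; apply: seminorm_le => s y sN.
by apply: partials_le_seminorm cK tp _; rewrite leq_max sN orbT.
Qed.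

Lemma continuous_op_partial K i : compact K ->
  continuous_op K K (partial i).
Proof.
move=> cK; apply: continuous_op_intro (cK) _ _ => [phi tp|s].
  have [sp _ _] := tp.
  apply: test_function_intro (cK) (smooth_partial i sp) _ => x Kx.
  apply: (@partial_eq0 i K phi x (compact_rV_closed cK)) => //.
  by move=> y; exact: test_function_eq0 tp.
have [C [N CN]] := seminorm_bounded_partials (rcons s i) cK.
exists C, N; split=> [|phi tp x]; first exact: CN.1.
by rewrite -partials_rcons; exact: CN.2.
Qed.

Lemma continuous_op_linear K K' (a : R) A B : compact K -> compact K' ->
  continuous_op K K' A -> continuous_op K K' B ->
  continuous_op K K' (fun phi x => a * A phi x + B phi x).
Proof.
move=> cK cK' cA cB; apply: continuous_op_intro => // [phi tp|s].
  by apply: test_function_linear; [exact: cA.1|exact: cB.1].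
have [C [N [C0 CN]]] := seminorm_bounded_linear a cK
  (continuous_op_bounded s cK' cA) (continuous_op_bounded s cK' cB).
exists C, N; split=> // phi tp x; rewrite partials_linear ?CN//.
  by have [] := cA.1 _ tp.
by have [] := cB.1 _ tp.
Qed.

Lemma continuous_op_id K : continuous_op K K id.
Proof. by split=> // N; exists 1, N; split=> // phi _; rewrite mul1r. Qed.

Lemma continuous_op0 K K' : continuous_op K K' (fun _ => cst 0).
Proof.
split=> [phi _|N]; first exact: test_function0.
exists 0, 0; split=> // phi _; rewrite mul0r.
apply: le_trans (@seminorm_le N _ 0 _) _; last by rewrite mulr0.
by move=> s x _; rewrite partials_cst; case: s => *; rewrite normr0.
Qed.

Lemma continuous_op_sum (I : Type) (r : seq I) K K' A : compact K -> compact K' ->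
  (forall k : I, continuous_op K K' (A k)) ->
  continuous_op K K' (fun phi x => \sum_(k <- r) A k phi x).
Proof.
move=> cK cK' cA; elim: r => [|k r IH].
  have := continuous_op0 K K'; congr continuous_op.
  by apply/funext => phi; apply/funext => x; rewrite big_nil.
have := continuous_op_linear 1 cK cK' (cA k) IH; congr continuous_op.
by apply/funext => phi; apply/funext => x; rewrite big_cons mul1r.
Qed.

Lemma continuous_op_mulcoord K k : compact K ->
  continuous_op K K (fun phi x => x 0 k * phi x).
Proof.
move=> cK.
have tk phi : test_function K phi -> test_function K (fun x => x 0 k * phi x).
  move=> tp; have [sp _ _] := tp.
  apply: test_function_intro cK (smooth_mulcoord k sp) _ => x Kx.
  by rewrite (test_function_eq0 tp Kx) mulr0.
(* Induction from the end of the list, where the innermost derivative sits: [partial i] of [x_k phi]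
   is [[k = i] phi + x_k (partial i phi)], and the hypothesis applies to [partial i phi]. In the
   base case the coordinate is bounded on [K]. *)
apply: continuous_op_intro => // s; elim/last_ind: s => [|s i IH].
  have /compact_bounded[M [_ /(_ (M + 1))]] : compact ((fun x : 'rV[R]_n => x 0 k) @` K).
    apply: continuous_compact => //; apply: continuous_subspaceT => x.
    exact: coord_continuous.
  rewrite ltrDl ltr01 => /(_ isT) HM.
  exists `|M + 1|, 0; split=> // phi tp x /=; rewrite normrM.
  have [Kx|nKx] := pselect (K x); last first.
    by rewrite (test_function_eq0 tp nKx) normr0 mulr0 mulr_ge0// seminorm_ge0.
  rewrite ler_pM//; last exact: (@partials_le_seminorm K 0 [::]).
  by apply: le_trans (ler_norm _); apply: HM; exists x.
have := seminorm_bounded_linear (k == i)%:R cK (seminorm_bounded_partials s cK)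
  (seminorm_bounded_comp (continuous_op_partial i cK) IH).
move=> [C [N [C0 CN]]]; exists C, N; split=> // phi tp x.
have [sp _ _] := tp.
rewrite partials_rcons (partial_mulcoord _ _ sp).
rewrite (partials_linear _ _ sp (smooth_mulcoord k (smooth_partial i sp))).
exact: CN.
Qed.

(** * Multipliers of test functions, polynomials among them *)

Definition multiplier (p : 'rV[R]_n -> R) :=
  forall K, compact K -> continuous_op K K (fun phi x => p x * phi x).

Lemma multiplier_coord k : multiplier (fun x => x 0 k).
Proof. by move=> K cK; exact: continuous_op_mulcoord. Qed.

Lemma multiplier_cst (a : R) : multiplier (cst a).
Proof.
move=> K cK; have := continuous_op_linear a cK cK (continuous_op_id K) (continuous_op0 K K).
congr continuous_op; apply/funext => phi; apply/funext => x /=.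
by rewrite addr0.
Qed.

Lemma multiplierD p q : multiplier p -> multiplier q ->
  multiplier (fun x => p x + q x).
Proof.
move=> mp mq K cK; have := continuous_op_linear 1 cK cK (mp K cK) (mq K cK).
congr continuous_op; apply/funext => phi; apply/funext => x /=.
by rewrite mul1r mulrDl.
Qed.

Lemma multiplierM p q : multiplier p -> multiplier q ->
  multiplier (fun x => p x * q x).
Proof.
move=> mp mq K cK; have := continuous_op_comp (mq K cK) (mp K cK).
congr continuous_op; apply/funext => phi; apply/funext => x /=.
by rewrite mulrA.
Qed.

Lemma test_function_mul Omega p phi : multiplier p ->
  test_function Omega phi -> test_function Omega (fun x => p x * phi x).
Proof.
move=> mp tp; have [_ cp pO] := tp; apply: (test_functionW pO).
exact: (mp _ cp).1 _ (test_function_supp tp).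
Qed.

Lemma test_function_partial Omega i phi :
  test_function Omega phi -> test_function Omega (partial i phi).
Proof.
move=> tp; have [_ cp pO] := tp; apply: (test_functionW pO).
exact: (continuous_op_partial i cp).1 _ (test_function_supp tp).
Qed.

End SmoothFunctions.
Arguments smooth_continuous {R n f} sf x : rename.
Arguments smooth_derivable {R n f} sf i x : rename.

(** * Directional derivatives *)

Section DirectionalDerivative.
#[local] Set Implicit Arguments.
#[local] Unset Strict Implicit.
Variables (R : realType) (n : nat).
Implicit Types (f : 'rV[R]_n -> R).

(** The difference quotients agree. The one-variable form gives access to the mean value theorem and
    to the chain rule. *)
Lemma is_derive_line (V : normedModType R) (f : V -> R) x v df :
  is_derive x v f df <-> is_derive (0 : R) (1 : R) (fun h : R => f (h *: v + x)) df.
Proof.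
have e : (fun h : R => h^-1 *: ((f \o shift x) (h *: v) - f x)) =
    (fun h : R => h^-1 *: (((fun h : R => f (h *: v + x)) \o shift 0) (h *: 1)
      - f (0 *: v + x))).
  by apply/funext => h /=; rewrite addr0 scale0r add0r [_%:A]mulr1.
by split=> -[]; rewrite /derivable /derive => h1 h2; split;
  rewrite /derivable /derive; move: h1 h2; rewrite e.
Qed.

(** The mean value theorem between 0 and [a], whatever the sign of [a]. Of the intermediate point
    only the size is recorded, which suffices for passing to the limit. *)
Lemma smooth_MVT f y i (a : R) : smooth f ->
  exists2 t, `|t| <= `|a| &
    f (a *: delta_mx 0 i + y) - f y = partial i f (t *: delta_mx 0 i + y) * a.
Proof.
move=> sf; pose g (t : R) := f (t *: delta_mx 0 i + y).
have dg (t : R) : is_derive t (1 : R) g (partial i f (t *: delta_mx 0 i + y)).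
  apply/is_derive_line.
  have /derivableP/is_derive_line := smooth_derivable sf i (t *: delta_mx 0 i + y).
  congr is_derive; apply/funext => h.
  by rewrite /g [_%:A]mulr1 scalerDl addrA.
have cg (A : set R) : {within A, continuous g}.
  apply: continuous_subspaceT => t.
  by apply/differentiable_continuous/derivable1_diffP; have [] := dg t.
have g0 : f y = g 0 by rewrite /g scale0r add0r.
rewrite g0 -/(g a).
have [a0|a0] := leP 0 a.
  have [t ta ->] := MVT_segment a0 (fun t _ => dg t) (cg _).
  exists t; last by rewrite subr0.
  by move: ta; rewrite in_itv/= => /andP[t0 ta]; rewrite !ger0_norm.
have [t ta e] := MVT_segment (ltW a0) (fun t _ => dg t) (cg _).
exists t; last by rewrite -opprB e sub0r mulrN opprK.
by move: ta; rewrite in_itv/= => /andP[at0 t0]; rewrite !ler0_norm ?lerN2 ?(ltW a0).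
Qed.

(** The increment along [c e_i + v] is the increment along [v] from [x], followed by one along [e_i]
    from [h v + x]. The mean value theorem and the continuity of [partial i f] at [x] give the limit
    of the second quotient. *)
Lemma is_derive_add_coord f x v (c : R) i df : smooth f ->
  is_derive x v f df ->
  is_derive x (c *: delta_mx 0 i + v) f (c * partial i f x + df).
Proof.
move=> sf [dfv <-].
pose e_i : 'rV[R]_n := delta_mx 0 i.
pose r (h : R) := h^-1 *: (f ((h * c) *: e_i + (h *: v + x)) - f (h *: v + x)).
suff rP : r @ 0^' --> c * partial i f x.
  suff H : (fun h => h^-1 *: ((f \o shift x) (h *: (c *: e_i + v)) - f x)) @ 0^'
      --> c * partial i f x + 'D_v f x.
    by split; [apply/cvg_ex; exists (c * partial i f x + 'D_v f x)|exact/cvg_lim].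
  have -> : (fun h => h^-1 *: ((f \o shift x) (h *: (c *: e_i + v)) - f x)) =
      r \+ (fun h => h^-1 *: ((f \o shift x) (h *: v) - f x)).
    apply/funext => h; rewrite /r /= -scalerDr; congr (_ *: _).
    by rewrite scalerDr scalerA -[in LHS]addrA subrKA.
  exact: cvgD.
apply/cvgrPdist_lt => e e0.
have c0 : 0 < `|c| + 1 by rewrite ltr_wpDl.
have /cvgrPdist_lt/(_ (e / (`|c| + 1))) := smooth_continuous (smooth_partial i sf) x.
rewrite divr_gt0// => /(_ isT)/nbhs_ballP[del /= del0 Hdel].
(* [|h| * M] bounds the distance from [x] to the intermediate point, because [|t| <= |h c|]; the
   added 1 keeps [M] positive. *)
pose M := `|c| * `|e_i| + `|v| + 1.
have M0 : 0 < M by rewrite ltr_wpDl// addr_ge0// mulr_ge0.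
near=> h.
have h0 : h != 0 by near: h; exact: nbhs_dnbhs_neq.
have [t tle] := @smooth_MVT f (h *: v + x) i (h * c) sf.
rewrite /r -/e_i => ->.
rewrite [X in `|_ - X|](_ : _ = c * partial i f (t *: e_i + (h *: v + x))); last first.
  by rewrite /GRing.scale/=; field.
rewrite -mulrBr normrM.
have : `|partial i f x - partial i f (t *: e_i + (h *: v + x))| < e / (`|c| + 1).
  apply: Hdel; rewrite -ball_normE/= addrA opprD addrCA subrr addr0 normrN.
  apply: le_lt_trans (ler_normD _ _) _; rewrite !normrZ.
  apply: (@le_lt_trans _ _ (`|h| * M)).
    rewrite /M !mulrDr mulr1 -addrA lerD ?lerDl//.
    by rewrite mulrA -normrM ler_wpM2r.
  rewrite -ltr_pdivlMr//.
  by near: h; apply: dnbhs0_lt; rewrite divr_gt0.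
rewrite ltr_pdivlMr// mulrC; apply: le_lt_trans.
by rewrite ler_wpM2r// lerDl.
Unshelve. all: by end_near. Qed.

(* Continuity of the partial derivatives is what makes the directional
   derivative linear in the direction. *)
Lemma is_derive_direction f x v : smooth f ->
  is_derive x v f (\sum_i v 0 i * partial i f x).
Proof.
move=> sf; rewrite [X in is_derive x X](row_sum_delta v).
elim: (index_enum _) => [|i s IH]; first by rewrite !big_nil; exact: is_derive0.
by rewrite !big_cons; exact: is_derive_add_coord.
Qed.

End DirectionalDerivative.

(** * The change of variables and the pullback of test functions *)

Section ChangeOfVariables.
#[local] Set Implicit Arguments.
#[local] Unset Strict Implicit.
Variables (R : realType) (d : nat) (alpha : R).
Implicit Types (z y : 'rV[R]_(1 + d)) (phi psi f : 'rV[R]_(1 + d) -> R).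

Let i0 : 'I_(1 + d) := lshift d 0.
(** The [i]-th partial derivative of the weight. *)
Let alpha0 (i : 'I_(1 + d)) : R := alpha * (i == i0)%:R.

Lemma weight_line (h : R) i z :
  weight alpha (h *: delta_mx 0 i + z) = weight alpha z + h * alpha0 i.
Proof.
rewrite /weight /time !mxE eqxx/= /alpha0 -/i0 eq_sym; ring.
Qed.

(* The change of variables is projective, hence maps lines to lines. *)
Lemma change_line (h : R) i z :
  weight alpha z != 0 -> weight alpha z + h * alpha0 i != 0 ->
  change alpha (h *: delta_mx 0 i + z) =
  (h * (weight alpha z + h * alpha0 i)^-1) *:
    (delta_mx 0 i - alpha0 i *: change alpha z) + change alpha z.
Proof.
move=> w0 wh0; rewrite /change weight_line.
by apply/rowP => j; rewrite !mxE; field; rewrite w0 wh0.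
Qed.

Lemma weight_continuous : continuous (@weight R d alpha).
Proof.
move=> z.
have ct : @time R d @ z --> time z by exact: coord_continuous.
exact: cvgD (cvg_cst _) (cvgM ct (cvg_cst _)).
Qed.

Lemma change_continuous z : weight alpha z != 0 ->
  change alpha @ z --> change alpha z.
Proof.
move=> w0.
have cV : (fun y => (weight alpha y)^-1) @ z --> (weight alpha z)^-1.
  exact: cvgV w0 (@weight_continuous z).
exact: cvgZ cV cvg_id.
Qed.

(** By [change_line], the image of [h e_i + z] is [l(h) v + y] near [h = 0], with [l(0) = 0] and
    [l'(0) = w^-1]. The chain rule in one variable then leaves [w^-1] times the derivative of [f] at
    [y] along [v]. *)
Lemma is_derive_change f z i : smooth f -> weight alpha z != 0 ->
  is_derive z (delta_mx 0 i) (f \o change alpha)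
    ((weight alpha z)^-1 * (partial i f (change alpha z) -
      alpha0 i * \sum_k change alpha z 0 k * partial k f (change alpha z))).
Proof.
move=> sf w0; set w := weight alpha z; set y := change alpha z.
apply/is_derive_line.
pose v : 'rV[R]_(1 + d) := delta_mx 0 i - alpha0 i *: y.
pose l (h : R) := h * (w + h * alpha0 i)^-1.
apply: (@near_eq_is_derive _ _ _ ((fun t : R => f (t *: v + y)) \o l)).
  have wh0 : \forall h \near (0 : R), w + h * alpha0 i != 0.
    have : (fun h : R => w + h * alpha0 i) @ (0 : R) --> w.
      rewrite -[X in _ --> X](_ : w + 0 * alpha0 i = w); last by rewrite mul0r addr0.
      exact: cvgD (cvg_cst _) (cvgM cvg_id (cvg_cst _)).
    by move=> /cvgr_neq0; exact.
  by near=> h; rewrite /= change_line//; near: h.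
have -> : w^-1 * (partial i f y - alpha0 i * \sum_k y 0 k * partial k f y) =
    (\sum_k v 0 k * partial k f y) * w^-1.
  have vE k : v 0 k = (k == i)%:R - alpha0 i * y 0 k.
    by rewrite /v; move: (y) => y'; rewrite !mxE eqxx.
  rewrite mulrC; congr (_ * _); rewrite mulr_sumr -[partial i f y]mul1r.
  under [RHS]eq_bigr do rewrite vE mulrBl -mulrA.
  rewrite big_split/= sumrN; congr (_ - _).
  rewrite (bigD1 i)//= eqxx big1 ?addr0// => k ki.
  by rewrite (negbTE ki) mul0r.
apply: is_derive1_comp.
  have -> : l 0 = 0 by rewrite /l mul0r.
  exact: (is_derive_line f y v _).1 (is_derive_direction y v sf).
have dw : is_derive (0 : R) (1 : R) (fun h => w + h * alpha0 i) (alpha0 i).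
  have H := is_deriveD (is_derive_cst w (0 : R) (1 : R))
    (is_deriveM (is_derive_id (0 : R) (1 : R)) (is_derive_cst (alpha0 i) (0 : R) (1 : R))).
  by apply: is_derive_eq H _; rewrite scaler0 !add0r [_%:A]mulr1.
have w00 : w + 0 * alpha0 i != 0 by rewrite mul0r addr0.
have dl : is_derive (0 : R) (1 : R) l _ :=
  is_deriveM (is_derive_id (0 : R) (1 : R))
    (is_deriveV (f := fun h => w + h * alpha0 i) w00 dw).
apply: is_derive_eq dl _.
by rewrite /GRing.scale/= !mul0r addr0 add0r mulr1.
Unshelve. all: by end_near. Qed.

Lemma time_change z : time (change alpha z) = (weight alpha z)^-1 * time z.
Proof. by rewrite /time /change mxE. Qed.

Lemma weightV z : weight alpha z != 0 ->
  (weight alpha z)^-1 = 1 - alpha * time (change alpha z).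
Proof. by rewrite time_change /weight => w0; field. Qed.

Variable tmax : \bar R.
Hypotheses (alpha_gt0 : 0 < alpha) (tmax_gt0 : (0 < tmax)%E).

Lemma slab_weight_gt0 z : slab tmax z -> 0 < weight alpha z.
Proof. by move=> [t0 _]; rewrite /weight addr_gt0// mulr_gt0. Qed.

(** Where the weight is positive, [t / (1 + t alpha)] increases with [t]; it is 0 at 0 and reaches
    or tends to [tau] at [tmax]. Positivity of the weight covers the boundary times of the slab as
    well. *)
Lemma slab_change z : 0 < weight alpha z ->
  slab (tau alpha tmax) (change alpha z) <-> slab tmax z.
Proof.
move=> w0; have wV0 : 0 < (weight alpha z)^-1 by rewrite invr_gt0.
rewrite /slab/= time_change pmulr_rgt0//.
case: tmax tmax_gt0 => [r| |]//=; rewrite ?lte_fin ?ltry => r0.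
  have r1 : 0 < 1 + alpha * r by rewrite addr_gt0// mulr_gt0.
  suff -> : ((weight alpha z)^-1 * time z < r / (1 + alpha * r)) = (time z < r) by [].
  rewrite mulrC ltr_pdivrMr// mulrAC ltr_pdivlMr// /weight.
  have -> : r * (1 + time z * alpha) = r + time z * (alpha * r) by ring.
  by rewrite mulrDr mulr1 ltrD2r.
suff -> : (weight alpha z)^-1 * time z < alpha^-1 by [].
rewrite mulrC ltr_pdivrMr// mulrC ltr_pdivlMr// /weight.
by rewrite ltrDr.
Qed.

Definition pullback phi z : R :=
  if z \in slab tmax then phi (change alpha z) else 0.

(** The operator in the variables [(s, y)] that corresponds to [partial i] through [pullback]; its
    coefficients are polynomials. *)
Definition pullback_partial i phi y : R :=
  (1 - alpha * time y) *
    (partial i phi y - alpha0 i * \sum_k y 0 k * partial k phi y).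

Lemma multiplier_onem : multiplier (fun y => 1 - alpha * time y).
Proof.
have := multiplierD (multiplier_cst 1) (multiplierM (multiplier_cst (- alpha))
  (multiplier_coord i0)).
by congr multiplier; apply/funext => y; rewrite mulNr.
Qed.

(** Where the weight is positive the cutoff is invisible: a point outside the slab is sent outside
    [slab (tau alpha tmax)], where [phi] is 0. *)
Lemma pullbackE phi z : test_function (slab (tau alpha tmax)) phi ->
  0 < weight alpha z -> pullback phi z = phi (change alpha z).
Proof.
move=> tp w0; rewrite /pullback; case: ifPn => // /negP zn.
rewrite (test_function_eq0 tp)// => /(slab_change w0) sz.
by apply: zn; rewrite inE.
Qed.

Lemma pullback_near phi z : test_function (slab (tau alpha tmax)) phi ->
  0 < weight alpha z -> \forall z' \near z, pullback phi z' = (phi \o change alpha) z'.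
Proof.
move=> tp w0; near=> z'; apply: pullbackE => //; near: z'.
by apply: (cvgr_gt (weight alpha z)) => //; exact: weight_continuous.
Unshelve. all: by end_near. Qed.

(** A nonpositive weight forces [t < 0], which remains true nearby. Together with [pullback_near]
    this gives a local expression of the pullback at every point. *)
Lemma pullback_near0 phi z : weight alpha z <= 0 ->
  \forall z' \near z, pullback phi z' = 0.
Proof.
move=> w0; near=> z'; rewrite /pullback ifF//; apply/negP; rewrite inE => -[tz' _].
suff : time z' < 0 by rewrite ltNge (ltW tz').
near: z'; apply: (cvgr_lt (time z)); first exact: coord_continuous.
rewrite -(pmulr_llt0 _ alpha_gt0).
by rewrite -(ltrD2l 1) addr0 (le_lt_trans w0).
Unshelve. all: by end_near. Qed.

Lemma continuous_op_pullback_partial i K : compact K ->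
  continuous_op K K (pullback_partial i).
Proof.
move=> cK.
have cS := continuous_op_sum (index_enum _) cK cK
  (fun k => continuous_op_comp (continuous_op_partial k cK) (continuous_op_mulcoord k cK)).
have := continuous_op_comp (continuous_op_linear (- alpha0 i) cK cK cS
  (continuous_op_partial i cK)) (multiplier_onem cK).
congr continuous_op; apply/funext => phi; apply/funext => y /=.
by rewrite /pullback_partial mulNr [- _ + _]addrC.
Qed.

Lemma test_function_pullback_partial Omega i phi : test_function Omega phi ->
  test_function Omega (pullback_partial i phi).
Proof.
move=> tp; have [_ cp pO] := tp; apply: (test_functionW pO).
exact: (continuous_op_pullback_partial i cp).1 _ (test_function_supp tp).
Qed.

Lemma is_derive_pullback phi z i : test_function (slab (tau alpha tmax)) phi ->
  is_derive z (delta_mx 0 i) (pullback phi) (pullback (pullback_partial i phi) z).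
Proof.
move=> tp; have [sp _ _] := tp; have [w0|w0] := leP (weight alpha z) 0.
  rewrite (nbhs_singleton (pullback_near0 _ w0)).
  have e := pullback_near0 phi w0.
  apply: (near_eq_is_derive _ (is_derive_cst (0 : R) z (delta_mx 0 i))).
  by near do apply/esym.
rewrite (pullbackE (test_function_pullback_partial i tp) w0).
have e := pullback_near tp w0.
have := is_derive_change i sp (lt0r_neq0 w0).
rewrite /pullback_partial weightV ?lt0r_neq0//.
by apply: near_eq_is_derive; near do apply/esym.
Unshelve. all: by end_near. Qed.

Lemma continuous_pullback phi : test_function (slab (tau alpha tmax)) phi ->
  continuous (pullback phi).
Proof.
move=> tp z; have [sp _ _] := tp; have [w0|w0] := leP (weight alpha z) 0.
  rewrite /continuous_at (nbhs_singleton (pullback_near0 _ w0)).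
  apply: (@cvg_near_cst _ _ (0 : R) (pullback phi) (nbhs z)).
  exact: pullback_near0.
rewrite /continuous_at (pullbackE tp w0).
apply: (cvg_trans (near_eq_cvg _) (cvg_comp _ _ (change_continuous (lt0r_neq0 w0))
  (smooth_continuous sp (change alpha z)))).
by have := pullback_near tp w0; apply: filterS => z' ->.
Qed.

Lemma partial_pullback i phi : test_function (slab (tau alpha tmax)) phi ->
  partial i (pullback phi) = pullback (pullback_partial i phi).
Proof.
by move=> tp; apply/funext => z; have [_ h] := is_derive_pullback z i tp; exact: h.
Qed.

Definition pullback_partials s phi := foldr pullback_partial phi s.

(** Iterates [partial_pullback]: smoothness of a pullback then reduces to continuity and first
    derivatives of pullbacks, and its seminorms to sup norms. *)
Lemma partials_pullback s phi : test_function (slab (tau alpha tmax)) phi ->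
  test_function (slab (tau alpha tmax)) (pullback_partials s phi) /\
  partials s (pullback phi) = pullback (pullback_partials s phi).
Proof.
move=> tp; elim: s => [//|i s [IH1 /= ->]]; split.
  exact: test_function_pullback_partial.
exact: partial_pullback.
Qed.

Lemma smooth_pullback phi : test_function (slab (tau alpha tmax)) phi ->
  smooth (pullback phi).
Proof.
move=> tp s; have [ts ->] := partials_pullback s tp.
split; first exact: continuous_pullback.
by move=> i x; have [h _] := is_derive_pullback x i ts; exact: h.
Qed.

Lemma slab_tau_gt0 y : slab (tau alpha tmax) y -> 0 < 1 - alpha * time y.
Proof.
move=> [s0]; rewrite subr_gt0.
case: tmax tmax_gt0 => [r| |]//=; rewrite lte_fin => r0.
  have r1 : 0 < 1 + alpha * r by rewrite addr_gt0// mulr_gt0.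
  rewrite lte_fin ltr_pdivlMr// => sr.
  rewrite -(ltr_pM2r r1) mul1r -mulrA.
  apply: (@lt_trans _ _ (alpha * r)); first by rewrite ltr_pM2l.
  by rewrite ltrDr.
by move=> sa; rewrite -(mulfV (lt0r_neq0 alpha_gt0)) ltr_pM2l.
Qed.

(** The inverse of [change]; it locates the support of a pullback. *)
Definition unchange y : 'rV[R]_(1 + d) := (1 - alpha * time y)^-1 *: y.

Lemma weight_unchange y : 1 - alpha * time y != 0 ->
  weight alpha (unchange y) = (1 - alpha * time y)^-1.
Proof. by rewrite /weight /unchange /time mxE => h; field. Qed.

Lemma unchangeK y : 1 - alpha * time y != 0 -> change alpha (unchange y) = y.
Proof.
by move=> h; rewrite /change weight_unchange// invrK scalerA divff// scale1r.
Qed.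

Lemma changeK z : weight alpha z != 0 -> unchange (change alpha z) = z.
Proof.
by move=> w0; rewrite /unchange -weightV// invrK scalerA divff// scale1r.
Qed.

Lemma slab_unchange y : slab (tau alpha tmax) y -> slab tmax (unchange y).
Proof.
move=> ys; have y0 := slab_tau_gt0 ys.
by apply/slab_change; rewrite ?unchangeK ?weight_unchange ?invr_gt0 ?lt0r_neq0.
Qed.

Lemma unchange_continuous y : 1 - alpha * time y != 0 ->
  unchange @ y --> unchange y.
Proof.
move=> h.
have ct : @time R d @ y --> time y by exact: coord_continuous.
have ca : (fun y' : 'rV[R]_(1 + d) => 1 - alpha * time y') @ y --> 1 - alpha * time y.
  exact: cvgB (cvg_cst _) (cvgM (cvg_cst _) ct).
have cV : (fun y' => (1 - alpha * time y')^-1) @ y --> (1 - alpha * time y)^-1.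
  exact: cvgV h ca.
exact: cvgZ cV cvg_id.
Qed.

Lemma compact_unchange K : compact K -> K `<=` slab (tau alpha tmax) ->
  compact (unchange @` K).
Proof.
move=> cK Ks; apply: continuous_compact => //.
apply: continuous_in_subspaceT => y; rewrite inE => /Ks/slab_tau_gt0 y0.
by apply: unchange_continuous; rewrite lt0r_neq0.
Qed.

Lemma pullback_eq0 K phi z : test_function K phi ->
  ~ (unchange @` K) z -> pullback phi z = 0.
Proof.
move=> tp Kz; rewrite /pullback; case: ifPn => //; rewrite inE => zs.
apply: (test_function_eq0 tp) => Kcz; apply: Kz; exists (change alpha z) => //.
by apply: changeK; rewrite lt0r_neq0// slab_weight_gt0.
Qed.

(** The inverse map, continuous on [K], carries supports into a compact set. A pullback takes values
    of its argument or 0, so sup norms do not increase, and derivatives turn into operators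
    continuous on [K] applied beforehand. *)
Lemma continuous_op_pullback K : compact K -> K `<=` slab (tau alpha tmax) ->
  continuous_op K (unchange @` K) pullback.
Proof.
move=> cK Ks; apply: continuous_op_intro => // [phi tp|s].
  apply: test_function_intro (compact_unchange cK Ks)
    (smooth_pullback (test_functionW Ks tp)) _ => z.
  exact: pullback_eq0.
have cs : continuous_op K K (pullback_partials s).
  elim: s => [|i s IH]; first exact: continuous_op_id.
  exact: continuous_op_comp IH (continuous_op_pullback_partial i cK).
have [C [N [C0 CN]]] := continuous_op_bounded [::] cK cs.
exists C, N; split=> // phi tp z.
rewrite (partials_pullback s (test_functionW Ks tp)).2 /pullback.
case: ifPn => _; first exact: CN.
by rewrite normr0 mulr_ge0// seminorm_ge0.
Qed.

Lemma test_function_pullback phi : test_function (slab (tau alpha tmax)) phi ->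
  test_function (slab tmax) (pullback phi).
Proof.
move=> tp; have [_ cp ps] := tp.
apply: (@test_functionW _ _ (unchange @` supp phi)).
  by move=> _ [y /ps ys <-]; exact: slab_unchange.
exact: (continuous_op_pullback cp ps).1 _ (test_function_supp tp).
Qed.

Lemma pullback_linear (a : R) phi psi :
  pullback (fun y => a * phi y + psi y) =
  (fun z => a * pullback phi z + pullback psi z).
Proof.
by apply/funext => z; rewrite /pullback; case: ifP => // _; rewrite mulr0 addr0.
Qed.

(** Composition of [u] with the continuous linear operator that multiplies by [p] and pulls back;
    the estimate on [K] comes from that of [u] on the image of [K] by [unchange]. *)
Lemma is_distribution_pullback u p : is_distribution (slab tmax) u ->
  multiplier p ->
  is_distribution (slab (tau alpha tmax))
    (fun phi => u (pullback (fun y => p y * phi y))).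
Proof.
move=> [uL uB] mp; split=> [a phi psi tp tq|K cK Ks].
  have tp' := test_function_pullback (test_function_mul mp tp).
  have tq' := test_function_pullback (test_function_mul mp tq).
  rewrite -uL// -pullback_linear; congr (u (pullback _)).
  by apply/funext => y; ring.
have Ks' : unchange @` K `<=` slab tmax.
  by move=> _ [y /Ks ys <-]; exact: slab_unchange.
have [C [N CN]] := uB _ (compact_unchange cK Ks) Ks'.
have cA := continuous_op_comp (mp K cK) (continuous_op_pullback cK Ks).
have [C' [N' [C'0 CN']]] := cA.2 N.
(* The constant in the definition of a distribution has no prescribed sign, hence the absolute
   value. *)
exists (`|C| * C'), N' => phi tp pK; have tKp : test_function K phi by case: tp.
have [tA1 tA2 tA3] := cA.1 _ tKp.
apply: le_trans (CN _ (test_functionW Ks' (cA.1 _ tKp)) tA3) _.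
apply: (@le_trans _ _ (`|C| * seminorm N (pullback (fun y => p y * phi y)))).
  by rewrite ler_wpM2r ?seminorm_ge0// ler_norm.
by rewrite -mulrA ler_wpM2l// CN'.
Qed.

End ChangeOfVariables.

(** * The Jacobian determinant *)

Section Jacobian.
#[local] Set Implicit Arguments.
#[local] Unset Strict Implicit.
Variables (R : realType) (d : nat) (alpha : R).
Implicit Types z : 'rV[R]_(1 + d).

Lemma differentiable_change z : weight alpha z != 0 ->
  differentiable (@change R d alpha) z.
Proof.
move=> w0.
have -> : @change R d alpha =
    \sum_k (fun z => ((weight alpha z)^-1 * z 0 k) *: (delta_mx 0 k : 'rV[R]_(1 + d))).
  apply/funext => z'; rewrite fct_sumE.
  transitivity ((weight alpha z')^-1 *: \sum_k z' 0 k *: (delta_mx 0 k : 'rV[R]_(1 + d))).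
    by rewrite -row_sum_delta.
  rewrite scaler_sumr; by apply: eq_bigr => k _; rewrite scalerA.
apply: differentiable_sum => k; apply: differentiableZl.
have dc i : differentiable (fun z : 'rV[R]_(1 + d) => z 0 i : R) z.
  exact: differentiable_coord.
apply: differentiableM (dc k); apply: differentiableV => //.
apply: differentiableD => //.
exact: differentiableM (dc _) (differentiable_cst _ _).
Qed.

(** Vectors are rows, so row [i] of the Jacobian is the derivative along [e_i]; [is_derive_change]
    is applied to the coordinate functions. *)
Lemma change_jacobian z i k : weight alpha z != 0 ->
  ('J (change alpha) z) i k = (weight alpha z)^-1 *
    ((k == i)%:R - alpha * (i == lshift d 0)%:R * change alpha z 0 k).
Proof.
move=> w0; have dz := differentiable_change w0.
have -> : ('J (change alpha) z) i k = ('D_(delta_mx 0 i) (change alpha) z) 0 k.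
  by rewrite deriveEjacobian// -rowE [RHS]mxE.
rewrite derive_mx; last exact: diff_derivable.
rewrite mxE.
have sk : smooth (fun y : 'rV[R]_(1 + d) => y 0 k).
  have := smooth_mulcoord k (@smooth_cst R (1 + d) 1).
  by congr smooth; apply/funext => y; rewrite mulr1.
have [_] := is_derive_change i sk w0.
have pk j y : partial j (fun y : 'rV[R]_(1 + d) => y 0 k) y = (k == j)%:R.
  by have [_ h] := is_derive_coord y k j; exact: h.
rewrite pk (bigD1 k)//= pk eqxx mulr1 big1 ?addr0.
  by move=> <-.
by move=> j jk; rewrite pk eq_sym (negbTE jk) mulr0.
Qed.

Lemma det_change_jacobian z : 0 < weight alpha z ->
  `|\det ('J (change alpha) z)| = (weight alpha z)^-1 ^+ d.+2.
Proof.
move=> w0; have wn0 := lt0r_neq0 w0.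
have := fun i k => change_jacobian i k wn0.
move: ('J (change alpha) z : 'M[R]_(1 + d)) => J JE.
(* The new time [s] does not depend on [x], so the matrix is block triangular, with [ds/dt = w^-2]
   in time and [w^-1] times the identity in space. The exponent is [2 + d]. *)
have -> : J = block_mx ((weight alpha z)^-1 ^+ 2)%:M (ursubmx J) 0 (weight alpha z)^-1%:M.
  rewrite -[LHS](@submxK _ 1 d 1 d); congr block_mx.
  - apply/matrixP => i j; rewrite !ord1 !mxE JE.
    rewrite !eqxx mulr1 -[change alpha z 0 _]/(time (change alpha z)).
    by rewrite -weightV// expr2 mulr1n.
  - apply/matrixP => i j; rewrite !mxE JE ord1 eq_lrshift eq_rlshift.
    by rewrite mulr0 mul0r subr0 mulr0.
  - apply/matrixP => i j; rewrite !mxE JE eq_rlshift.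
    by rewrite mulr0 mul0r subr0 eq_rshift eq_sym mulr_natr.
rewrite det_ublock !det_scalar expr1 -exprD ger0_norm// exprn_ge0//.
by rewrite invr_ge0 ltW.
Qed.

End Jacobian.

(** * Linear combinations of distributions *)

Section DistributionAlgebra.
#[local] Set Implicit Arguments.
#[local] Unset Strict Implicit.
Variables (R : realType) (n : nat) (Omega : set 'rV[R]_n).
Implicit Types (u v : ('rV[R]_n -> R) -> R) (f g : 'rV[R]_n -> R).

Lemma is_distribution_linear (a : R) u v :
  is_distribution Omega u -> is_distribution Omega v ->
  is_distribution Omega (fun phi => a * u phi + v phi).
Proof.
move=> [uL uB] [vL vB]; split=> [b phi psi tp tq|K cK Ks].
  by rewrite uL// vL//; ring.
have [C [N CN]] := uB _ cK Ks; have [C' [N' CN']] := vB _ cK Ks.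
exists (`|a| * `|C| * seminorm_terms R n N + `|C'| * seminorm_terms R n N'), (maxn N N').
move=> phi tp pK; have tK : test_function K phi by case: tp.
have le_max M : (M <= maxn N N')%N ->
    seminorm M phi <= seminorm_terms R n M * seminorm (maxn N N') phi.
  move=> MN; apply: seminorm_le => s x sM.
  by apply: partials_le_seminorm cK tK _; exact: leq_trans MN.
apply: le_trans (ler_normD _ _) _; rewrite normrM mulrDl lerD// -?mulrA.
  rewrite ler_wpM2l//; apply: le_trans (CN _ tp pK) _.
  apply: le_trans (ler_wpM2r (seminorm_ge0 _ _) (ler_norm C)) _.
  by rewrite ler_wpM2l// le_max// leq_maxl.
apply: le_trans (CN' _ tp pK) _.
apply: le_trans (ler_wpM2r (seminorm_ge0 _ _) (ler_norm C')) _.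
by rewrite ler_wpM2l// le_max// leq_maxr.
Qed.

Lemma is_distributionD u v : is_distribution Omega u -> is_distribution Omega v ->
  is_distribution Omega (u + v).
Proof.
move=> du dv; have := is_distribution_linear 1 du dv.
by congr is_distribution; apply/funext => phi; rewrite mul1r.
Qed.

Lemma is_distributionB u v : is_distribution Omega u -> is_distribution Omega v ->
  is_distribution Omega (u - v).
Proof.
move=> du dv; have := is_distribution_linear (-1) dv du.
by congr is_distribution; apply/funext => phi; rewrite mulN1r addrC.
Qed.

Variables (u : ('rV[R]_n -> R) -> R) (du : is_distribution Omega u).

Lemma distributionZ (a : R) f : test_function Omega f ->
  u (fun x => a * f x) = a * u f.
Proof.
have [uL _] := du => tf; have t0 := @test_function0 R n Omega.
(* Linearity is a single clause on [a phi + psi]; [a = 1] and two zero functions give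
   [u 0 = u 0 + u 0]. *)
have u0 : u (cst 0) = 0.
  have := uL 1 _ _ t0 t0; rewrite mul1r => /eqP.
  under eq_fun do rewrite mulr0 addr0.
  by rewrite -subr_eq0 opprD addrA subrr sub0r oppr_eq0 => /eqP.
by have := uL a _ _ tf t0; rewrite u0 addr0; under eq_fun do rewrite addr0.
Qed.

Lemma distributionD f g : test_function Omega f -> test_function Omega g ->
  u (fun x => f x + g x) = u f + u g.
Proof.
have [uL _] := du => tf tg; have := uL 1 _ _ tf tg.
by rewrite mul1r; under eq_fun do rewrite mul1r.
Qed.

Lemma distributionB f g : test_function Omega f -> test_function Omega g ->
  u (fun x => f x - g x) = u f - u g.
Proof.
have [uL _] := du => tf tg; have := uL (-1) _ _ tg tf.
by rewrite mulN1r addrC; under eq_fun do rewrite mulN1r addrC.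
Qed.

Lemma test_function_sum (I : Type) (r : seq I) (F : I -> 'rV[R]_n -> R) :
  (forall k, test_function Omega (F k)) ->
  test_function Omega (fun x => \sum_(k <- r) F k x).
Proof.
move=> tF; elim: r => [|k r IH].
  by under eq_fun do rewrite big_nil; exact: test_function0.
by under eq_fun do rewrite big_cons; exact: test_functionD.
Qed.

Lemma distribution_sum (I : Type) (r : seq I) (F : I -> 'rV[R]_n -> R) :
  (forall k, test_function Omega (F k)) ->
  u (fun x => \sum_(k <- r) F k x) = \sum_(k <- r) u (F k).
Proof.
move=> tF; elim: r => [|k r IH].
  under eq_fun do rewrite big_nil; rewrite big_nil.
  have := distributionZ 0 (@test_function0 R n Omega).
  by rewrite mul0r; under eq_fun do rewrite mul0r.
under eq_fun do rewrite big_cons.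
by rewrite big_cons -IH distributionD//; exact: test_function_sum.
Qed.

End DistributionAlgebra.

(** * The entries of the transformed tensor *)

Section TransformedTensor.
#[local] Set Implicit Arguments.
#[local] Unset Strict Implicit.
Variables (R : realType) (d : nat) (alpha : R) (tmax : \bar R).
Hypotheses (alpha_gt0 : 0 < alpha) (tmax_gt0 : (0 < tmax)%E).
Variables (rho : ('rV[R]_(1 + d) -> R) -> R)
  (m : 'cV[('rV[R]_(1 + d) -> R) -> R]_d)
  (T : 'M[('rV[R]_(1 + d) -> R) -> R]_d).
Implicit Types (phi p g : 'rV[R]_(1 + d) -> R).

Local Notation Q := (pullback alpha tmax).
Local Notation a := (fun y => 1 - alpha * time y).
Local Notation Omega := (slab tmax).
Local Notation Omega' := (slab (tau alpha tmax)).
Local Notation Sb := (tensor_bar alpha rho m T tmax).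

(** The Jacobian factor combines with [g], and [p] is the outcome in the new variables. Off the slab
    both test functions are 0. *)
Lemma transport_mul g p u :
  (forall z, Omega z ->
    g z * (weight alpha z)^-1 ^+ d.+2 = p (change alpha z)) ->
  dist_transport Omega (change alpha) (dist_mul g u) =
  (fun phi => u (Q (fun y => p y * phi y))).
Proof.
move=> gp; apply/funext => phi; congr u; apply/funext => z.
rewrite /pullback; case: ifPn => [|_]; last by rewrite mulr0.
rewrite inE => zO; rewrite mulrA det_change_jacobian ?gp//.
exact: slab_weight_gt0 zO.
Qed.

Let weight_neq0 (z : 'rV[R]_(1 + d)) : Omega z -> weight alpha z != 0.
Proof. by move=> /(slab_weight_gt0 alpha_gt0)/lt0r_neq0. Qed.

(** Exponent count, here and in the next two lemmas: since [x = w y], a coefficient [w^k] with [j]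
    factors [x] becomes [a^(d + 2 - k - j)] with [j] factors [y]. *)
Lemma rho_barE : dist_transport Omega (change alpha) (rho_bar alpha rho) =
  (fun phi => rho (Q (fun y => a y * a y * phi y))).
Proof.
apply: transport_mul => z zO; have w0 := weight_neq0 zO.
by rewrite -weightV// exprVn !exprS; field; rewrite expf_neq0 ?w0.
Qed.

Lemma m_barE i : dist_transport Omega (change alpha) (m_bar alpha rho m i 0) =
  (fun phi => m i 0 (Q (fun y => a y * phi y))) -
  (fun phi => rho (Q (fun y => alpha * (a y * Defs.space i y) * phi y))).
Proof.
rewrite mxE.
(* Multiplication and transport act by precomposition and functionals are added pointwise, so the
   two sides are convertible. *)
rewrite [LHS](_ : _ =
  dist_transport Omega (change alpha) (dist_mul (fun z => weight alpha z ^+ d.+1) (m i 0)) -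
  dist_transport Omega (change alpha)
    (dist_mul (fun z => alpha * weight alpha z ^+ d * Defs.space i z) rho)) //.
congr (_ - _); apply: transport_mul => z zO; have w0 := weight_neq0 zO.
  by rewrite -weightV// exprVn !exprS; field; rewrite expf_neq0 ?w0.
rewrite -weightV// exprVn !exprS /Defs.space mxE.
by field; rewrite expf_neq0 ?w0.
Qed.

Lemma T_barE i j : dist_transport Omega (change alpha) (T_bar alpha rho m T i j) =
  (fun phi => T i j (Q phi)) -
  ((fun phi => m i 0 (Q (fun y => alpha * Defs.space j y * phi y))) +
   (fun phi => m j 0 (Q (fun y => alpha * Defs.space i y * phi y)))) +
  (fun phi => rho (Q (fun y => alpha ^+ 2 * (Defs.space i y * Defs.space j y) * phi y))).
Proof.
rewrite mxE.
rewrite [LHS](_ : _ =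
  dist_transport Omega (change alpha) (dist_mul (fun z => weight alpha z ^+ d.+2) (T i j)) -
  (dist_transport Omega (change alpha)
     (dist_mul (fun z => alpha * weight alpha z ^+ d.+1) (dist_mul (Defs.space j) (m i 0))) +
   dist_transport Omega (change alpha)
     (dist_mul (fun z => alpha * weight alpha z ^+ d.+1) (dist_mul (Defs.space i) (m j 0)))) +
  dist_transport Omega (change alpha)
    (dist_mul (fun z => alpha ^+ 2 * weight alpha z ^+ d * (Defs.space i z * Defs.space j z)) rho)) //.
have dist_mulA g h u : dist_mul g (dist_mul h u) = dist_mul (fun z => h z * g z) u.
  by apply/funext => phi; congr u; apply/funext => z; rewrite mulrA.
congr (_ - (_ + _) + _); rewrite ?dist_mulA.
- rewrite (@transport_mul _ (cst 1)).
    by apply/funext => phi; congr (T i j (Q _)); apply/funext => y; rewrite mul1r.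
  move=> z zO; have w0 := weight_neq0 zO.
  by rewrite -exprMn mulfV// expr1n.
- apply: transport_mul => z zO; have w0 := weight_neq0 zO.
  by rewrite exprVn !exprS /Defs.space mxE; field; rewrite expf_neq0 ?w0.
- apply: transport_mul => z zO; have w0 := weight_neq0 zO.
  by rewrite exprVn !exprS /Defs.space mxE; field; rewrite expf_neq0 ?w0.
- apply: transport_mul => z zO; have w0 := weight_neq0 zO.
  by rewrite exprVn !exprS /Defs.space !mxE; field; rewrite expf_neq0 ?w0.
Qed.

Lemma tensor_bar00 i j phi : Sb (lshift d i) (lshift d j) phi =
  rho (Q (fun y => a y * a y * phi y)).
Proof. by rewrite mxE block_mxEul mxE rho_barE. Qed.

Lemma tensor_bar0x i j phi : Sb (lshift d i) (rshift 1 j) phi =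
  m j 0 (Q (fun y => a y * phi y)) -
  rho (Q (fun y => alpha * (a y * Defs.space j y) * phi y)).
Proof. by rewrite mxE block_mxEur [m_bar _ _ _]lock mxE -lock ord1 m_barE. Qed.

Lemma tensor_barx0 i j phi : Sb (rshift 1 i) (lshift d j) phi =
  m i 0 (Q (fun y => a y * phi y)) -
  rho (Q (fun y => alpha * (a y * Defs.space i y) * phi y)).
Proof. by rewrite mxE block_mxEdl ord1 m_barE. Qed.

Lemma tensor_barxx i j phi : Sb (rshift 1 i) (rshift 1 j) phi =
  T i j (Q phi) -
  (m i 0 (Q (fun y => alpha * Defs.space j y * phi y)) +
   m j 0 (Q (fun y => alpha * Defs.space i y * phi y))) +
  rho (Q (fun y => alpha ^+ 2 * (Defs.space i y * Defs.space j y) * phi y)).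
Proof. by rewrite mxE block_mxEdr T_barE. Qed.

(** * Distributional entries and symmetry *)

Hypothesis S_distr : distributional Omega (tensor rho m T).

Lemma distribution_rho : is_distribution Omega rho.
Proof. by have := S_distr (lshift d 0) (lshift d 0); rewrite block_mxEul mxE. Qed.

Lemma distribution_m i : is_distribution Omega (m i 0).
Proof. by have := S_distr (rshift 1 i) (lshift d 0); rewrite block_mxEdl. Qed.

Lemma distribution_T i j : is_distribution Omega (T i j).
Proof. by have := S_distr (rshift 1 i) (rshift 1 j); rewrite block_mxEdr. Qed.

Let mult_a : multiplier a := @multiplier_onem R d alpha.

Let mult_x i : multiplier (@Defs.space R d i) := multiplier_coord _.

Let pull u p (du : is_distribution Omega u) (mp : multiplier p) :=
  is_distribution_pullback alpha_gt0 tmax_gt0 du mp.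

Lemma tensor_bar_distributional : distributional Omega' Sb.
Proof.
have d00 i j : is_distribution Omega' (Sb (lshift d i) (lshift d j)).
  rewrite (funext (tensor_bar00 i j)).
  exact: pull distribution_rho (multiplierM mult_a mult_a).
have dx i : is_distribution Omega'
    ((fun phi => m i 0 (Q (fun y => a y * phi y))) -
     (fun phi => rho (Q (fun y => alpha * (a y * Defs.space i y) * phi y)))).
  apply: is_distributionB; first exact: pull (distribution_m i) mult_a.
  exact: pull distribution_rho
    (multiplierM (multiplier_cst alpha) (multiplierM mult_a (mult_x i))).
have dxx i j : is_distribution Omega' (Sb (rshift 1 i) (rshift 1 j)).
  rewrite (funext (tensor_barxx i j)).
  apply: (is_distributionD (u := _ - (_ + _))).
    apply: is_distributionB.
      have := pull (distribution_T i j) (multiplier_cst 1).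
      congr is_distribution; apply/funext => phi; congr (T i j (Q _)).
      by apply/funext => y; rewrite mul1r.
    apply: is_distributionD.
      exact: pull (distribution_m i) (multiplierM (multiplier_cst alpha) (mult_x j)).
    exact: pull (distribution_m j) (multiplierM (multiplier_cst alpha) (mult_x i)).
  exact: pull distribution_rho
    (multiplierM (multiplier_cst (alpha ^+ 2)) (multiplierM (mult_x i) (mult_x j))).
move=> i j; rewrite -[i](@splitK 1 d) -[j](@splitK 1 d).
case: (fintype.split i) => i'; case: (fintype.split j) => j' /=; first exact: d00.
- by rewrite (funext (tensor_bar0x i' j')); exact: dx.
- by rewrite (funext (tensor_barx0 i' j')); exact: dx.
- exact: dxx.
Qed.

Hypothesis S_sym : symmetric_tensor Omega (tensor rho m T).

Lemma tensor_bar_symmetric : symmetric_tensor Omega' Sb.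
Proof.
move=> i j phi tp; rewrite -[i](@splitK 1 d) -[j](@splitK 1 d).
case: (fintype.split i) => i'; case: (fintype.split j) => j' /=.
- by rewrite !tensor_bar00.
- by rewrite tensor_bar0x tensor_barx0.
- by rewrite tensor_bar0x tensor_barx0.
rewrite !tensor_barxx [X in _ - X](addrC (m i' 0 _)); congr (_ - _ + rho (Q _)).
  (* The terms in [m] and [rho] are symmetric by commutativity; the term in [T] uses the symmetry of
     [S] tested against the pullback. *)
  have := S_sym (rshift 1 i') (rshift 1 j') (test_function_pullback alpha_gt0 tmax_gt0 tp).
  by rewrite !block_mxEdr.
by apply/funext => y; rewrite (mulrC (Defs.space i' y)).
Qed.

(** * Balance laws of mass and momentum *)

Lemma DivE (S : 'M[('rV[R]_(1 + d) -> R) -> R]_(1 + d)) i phi :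
  Div S i 0 phi = - (S i (lshift d 0) (partial (lshift d 0) phi) +
    \sum_j S i (rshift 1 j) (partial (rshift 1 j) phi)).
Proof.
rewrite mxE fct_sumE [LHS](@big_split_ord _ _ _ 1 d) big_ord1 opprD -sumrN.
by [].
Qed.

Hypothesis S_Div_free : Div_free Omega (tensor rho m T).

Lemma mass_balance psi : test_function Omega psi ->
  rho (partial (lshift d 0) psi) + \sum_j m j 0 (partial (rshift 1 j) psi) = 0.
Proof.
move=> /(S_Div_free (lshift d 0))/eqP; rewrite DivE oppr_eq0 => /eqP.
rewrite block_mxEul mxE.
by under eq_bigr do rewrite block_mxEur mxE.
Qed.

Lemma momentum_balance i psi : test_function Omega psi ->
  m i 0 (partial (lshift d 0) psi) + \sum_j T i j (partial (rshift 1 j) psi) = 0.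
Proof.
move=> /(S_Div_free (rshift 1 i))/eqP; rewrite DivE oppr_eq0 => /eqP.
rewrite block_mxEdl.
by under eq_bigr do rewrite block_mxEdr.
Qed.

Local Notation d_t := (partial (lshift d 0)).
Local Notation d_x j := (partial (rshift 1 j)).

(** On functions of [(s, y)], [d_t] and [d_x] stand for the derivatives in [s] and [y], and the sum
    is the Euler operator [s d_s + y . d_y]. The old time derivative is [a] times this operator. *)
Definition convective phi y : R :=
  d_t phi y - alpha * \sum_k y 0 k * partial k phi y.

Lemma pullback_partial_time phi : pullback_partial alpha (lshift d 0) phi =
  (fun y => a y * convective phi y).
Proof. by apply/funext => y; rewrite /pullback_partial eqxx mulr1. Qed.

Lemma pullback_partial_space j phi : pullback_partial alpha (rshift 1 j) phi =
  (fun y => a y * d_x j phi y).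
Proof.
by apply/funext => y; rewrite /pullback_partial eq_rlshift mulr0 mul0r subr0.
Qed.

(** The Euler operator contains [s d_s], which turns the coefficient of [d_t] into [a]; this is
    where the square of [a] in the density comes from. *)
Lemma convectiveE phi y : convective phi y =
  a y * d_t phi y - \sum_j alpha * (Defs.space j y * d_x j phi y).
Proof.
have e : \sum_k y 0 k * partial k phi y =
    time y * d_t phi y + \sum_j Defs.space j y * d_x j phi y.
  by rewrite (@big_split_ord _ _ _ 1 d) big_ord1.
rewrite /convective e -mulr_sumr; ring.
Qed.

Lemma test_function_convective phi : test_function Omega' phi ->
  test_function Omega' (convective phi).
Proof.
move=> tp; rewrite (funext (convectiveE phi)).
have := test_function_linear (-1) (test_function_sum (index_enum _) (fun j =>
    test_functionZ alpha (test_function_mul (mult_x j) (test_function_partial (rshift 1 j) tp))))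
  (test_function_mul mult_a (test_function_partial (lshift d 0) tp)).
by congr test_function; apply/funext => y; rewrite mulN1r addrC.
Qed.

(** The entries of the transformed tensor are combinations of polynomial multiples of such
    functionals. *)
Definition pull_distribution u phi : R := u (Q phi).
Local Notation V := pull_distribution.

Lemma is_distribution_pull u : is_distribution Omega u ->
  is_distribution Omega' (V u).
Proof.
move=> du; have := pull du (multiplier_cst 1); congr is_distribution.
apply/funext => phi; congr (u (Q _)); apply/funext => y; exact: mul1r.
Qed.

(* The mass balance tested with [Q phi]. *)
Lemma pull_mass_balance phi : test_function Omega' phi ->
  V rho (fun y => a y * convective phi y) +
  \sum_j V (m j 0) (fun y => a y * d_x j phi y) = 0.
Proof.
move=> tp; have := mass_balance (test_function_pullback alpha_gt0 tmax_gt0 tp).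
rewrite partial_pullback// pullback_partial_time.
by under eq_bigr do rewrite partial_pullback// pullback_partial_space.
Qed.

(* The mass balance tested with [x_i Q phi]. *)
Lemma pull_mass_balance_moment i phi : test_function Omega' phi ->
  V rho (fun y => Defs.space i y * convective phi y) +
  \sum_j V (m j 0) (fun y => (i == j)%:R * phi y + Defs.space i y * d_x j phi y) = 0.
Proof.
move=> tp; have tQ := test_function_pullback alpha_gt0 tmax_gt0 tp.
have [sQ _ _] := tQ.
have := mass_balance (test_function_mul (mult_x i) tQ).
rewrite /Defs.space partial_mulcoord// partial_pullback// pullback_partial_time.
rewrite eq_rlshift.
under eq_bigr do rewrite partial_mulcoord// partial_pullback// pullback_partial_space eq_rshift.
move=> H; rewrite -[RHS]H; congr (_ + _).
  (* On the slab [x_i = w y_i] and [a = w^-1], so [x_i a] becomes [y_i]; off it both sides are 0. *)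
  congr rho; apply/funext => z; rewrite mul0r add0r /pullback.
  case: ifPn; last by rewrite mulr0.
  rewrite inE => zO; rewrite -weightV ?weight_neq0// mxE; ring.
apply: eq_bigr => j _; congr (m j 0); apply/funext => z; rewrite /pullback.
case: ifPn; last by rewrite !mulr0 addr0.
rewrite inE => zO; rewrite -weightV ?weight_neq0// mxE; ring.
Qed.

(* The momentum balance tested with [(1 + t alpha) Q phi]. *)
Lemma pull_momentum_balance i phi : test_function Omega' phi ->
  V (m i 0) (fun y => alpha * phi y + convective phi y) +
  \sum_j V (T i j) (d_x j phi) = 0.
Proof.
move=> tp; have tQ := test_function_pullback alpha_gt0 tmax_gt0 tp.
have [sQ _ _] := tQ; have sxQ := smooth_mulcoord (lshift d 0) sQ.
(* The test function is [alpha (t Q phi) + Q phi]. Its factor [1 + t alpha] cancels the [a] that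
   comes from differentiating the pullback, and the time derivative of this factor leaves
   [alpha phi]. *)
have := momentum_balance i (test_function_linear alpha
  (test_function_mul (multiplier_coord (lshift d 0)) tQ) tQ).
rewrite partial_linear// partial_mulcoord// partial_pullback// pullback_partial_time eqxx.
under eq_bigr do rewrite partial_linear// partial_mulcoord// partial_pullback//
  pullback_partial_space eq_lrshift.
move=> H; rewrite -[RHS]H; congr (_ + _).
  congr (m i 0); apply/funext => z; rewrite /pullback.
  case: ifPn; last by rewrite !mulr0 !addr0 mulr0.
  rewrite inE => zO; have w0 := weight_neq0 zO; rewrite -weightV//.
  rewrite -[z 0 (lshift d 0)]/(time z) -[true%:R]/(1 : R).
  by move: w0; rewrite /weight => w0; field.
apply: eq_bigr => j _; congr (T i j); apply/funext => z; rewrite /pullback.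
case: ifPn; last by rewrite !mulr0 !addr0 mulr0.
rewrite inE => zO; have w0 := weight_neq0 zO; rewrite -weightV//.
rewrite -[z 0 (lshift d 0)]/(time z) -[false%:R]/(0 : R).
by move: w0; rewrite /weight => w0; field.
Qed.

(** Expanding [convective] in [pull_mass_balance] yields the products [y_j d_x j phi], which are the
    corrections by [rho] in the momentum. *)
Lemma tensor_bar_mass_balance phi : test_function Omega' phi ->
  V rho (fun y => a y * a y * d_t phi y) +
  \sum_j (V (m j 0) (fun y => a y * d_x j phi y) -
    V rho (fun y => alpha * (a y * Defs.space j y) * d_x j phi y)) = 0.
Proof.
move=> tp; have dV := is_distribution_pull distribution_rho.
have td := test_function_partial (lshift d 0) tp.
have tx j := test_function_partial (rshift 1 j) tp.
rewrite -[RHS](pull_mass_balance tp) big_split/= sumrN addrCA addrC; congr (_ + _).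
pose F j y := alpha * (a y * Defs.space j y) * d_x j phi y.
have tF j : test_function Omega' (F j).
  exact: test_function_mul
    (multiplierM (multiplier_cst alpha) (multiplierM mult_a (mult_x j))) (tx j).
rewrite -(distribution_sum dV _ tF).
rewrite -(distributionB dV (test_function_mul (multiplierM mult_a mult_a) td)
  (test_function_sum _ tF)).
congr (V rho _); apply/funext => y; rewrite convectiveE [RHS]mulrBr [in RHS]mulrA [in RHS]mulr_sumr.
by congr (_ - _); apply: eq_bigr => j _; rewrite /F; ring.
Qed.

(** Both [pull_momentum_balance] and [alpha] times [pull_mass_balance_moment] contain
    [alpha V (m i 0) phi], the former from the derivative of [1 + t alpha] and the latter from that
    of [x_i]; subtraction cancels it. *)
Lemma tensor_bar_momentum_balance i phi : test_function Omega' phi ->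
  V (m i 0) (fun y => a y * d_t phi y) -
  V rho (fun y => alpha * (a y * Defs.space i y) * d_t phi y) +
  \sum_j (V (T i j) (d_x j phi) -
    (V (m i 0) (fun y => alpha * Defs.space j y * d_x j phi y) +
     V (m j 0) (fun y => alpha * Defs.space i y * d_x j phi y)) +
    V rho (fun y => alpha ^+ 2 * (Defs.space i y * Defs.space j y) * d_x j phi y)) = 0.
Proof.
move=> tp; have dr := is_distribution_pull distribution_rho.
have dm j := is_distribution_pull (distribution_m j).
have td := test_function_partial (lshift d 0) tp.
have tx j := test_function_partial (rshift 1 j) tp.
pose F j y := alpha * Defs.space j y * d_x j phi y.
have tF j : test_function Omega' (F j).
  exact: test_function_mul (multiplierM (multiplier_cst alpha) (mult_x j)) (tx j).
pose G j y := alpha ^+ 2 * (Defs.space i y * Defs.space j y) * d_x j phi y.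
have tG j : test_function Omega' (G j).
  exact: test_function_mul
    (multiplierM (multiplier_cst _) (multiplierM (mult_x i) (mult_x j))) (tx j).
have Em : V (m i 0) (fun y => alpha * phi y + convective phi y) =
    alpha * V (m i 0) phi + V (m i 0) (fun y => a y * d_t phi y) -
    \sum_j V (m i 0) (F j).
  rewrite (distributionD (dm i)) ?(distributionZ (dm i))//; first last.
  - exact: test_function_convective.
  - exact: test_functionZ.
  rewrite -addrA; congr (_ + _); rewrite -(distribution_sum (dm i) _ tF).
  rewrite -(distributionB (dm i) (test_function_mul mult_a td) (test_function_sum _ tF)).
  congr (V _ _); apply/funext => y; rewrite convectiveE; congr (_ - _).
  by apply: eq_bigr => j _; rewrite mulrA.
have Er : alpha * V rho (fun y => Defs.space i y * convective phi y) =
    V rho (fun y => alpha * (a y * Defs.space i y) * d_t phi y) -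
    \sum_j V rho (G j).
  rewrite -(distribution_sum dr _ tG).
  rewrite -(distributionB dr (test_function_mul (multiplierM (multiplier_cst alpha)
    (multiplierM mult_a (mult_x i))) td) (test_function_sum _ tG)).
  rewrite -(distributionZ dr) //; last first.
    exact: test_function_mul (mult_x i) (test_function_convective tp).
  congr (V _ _); apply/funext => y; rewrite convectiveE !mulrBr !mulr_sumr.
  congr (_ - _); first by rewrite /cst; ring.
  by apply: eq_bigr => j _; rewrite /G; ring.
have Es : alpha * \sum_j V (m j 0) (fun y => (i == j)%:R * phi y + Defs.space i y * d_x j phi y) =
    alpha * V (m i 0) phi +
    \sum_j V (m j 0) (fun y => alpha * Defs.space i y * d_x j phi y).
  have txx j := test_function_mul (mult_x i) (tx j).
  transitivity (\sum_j (alpha * ((i == j)%:R * V (m j 0) phi) +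
      V (m j 0) (fun y => alpha * Defs.space i y * d_x j phi y))).
    rewrite mulr_sumr; apply: eq_bigr => j _.
    have -> : (fun y => alpha * Defs.space i y * d_x j phi y) =
        (fun y => alpha * (Defs.space i y * d_x j phi y)).
      by apply/funext => y; rewrite mulrA.
    by rewrite (distributionZ (dm j))// -mulrDr; congr (_ * _); exact: (dm j).1.
  rewrite big_split/= -mulr_sumr (bigD1 i)//= eqxx mul1r big1 ?addr0// => j ji.
  by rewrite eq_sym (negbTE ji) mul0r.
have := pull_momentum_balance i tp; rewrite Em.
have := congr1 ( *%R alpha) (pull_mass_balance_moment i tp).
rewrite mulrDr mulr0 Er Es => Hr Hm.
(* [x] is the common term [alpha V (m i 0) phi], [A] and [B] are the time terms in [m i] and [rho],
   and [sF], [sT], [sM], [sG] the sums over [j] of the terms in [m i], [T i j], [m j] and [rho]. *)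
have combine (x A B sF sT sM sG : R) : x + A - sF + sT = 0 ->
    B - sG + (x + sM) = 0 -> A - B + (sT - (sF + sM) + sG) = 0 by lra.
by rewrite !big_split/= sumrN big_split/=; exact: combine Hm Hr.
Qed.

Lemma tensor_bar_Div_free : Div_free Omega' Sb.
Proof.
move=> i phi tp; rewrite DivE; apply/eqP; rewrite oppr_eq0; apply/eqP.
rewrite -[i](@splitK 1 d); case: (fintype.split i) => i' /=.
  rewrite tensor_bar00; under eq_bigr do rewrite tensor_bar0x.
  exact: tensor_bar_mass_balance.
rewrite tensor_barx0; under eq_bigr do rewrite tensor_barxx.
exact: tensor_bar_momentum_balance.
Qed.

End TransformedTensor.

Theorem proposition2p1 (R : realType) (d : nat) (d_ge1 : (1 <= d)%N)
    (tmax : \bar R) (tmax_gt0 : (0 < tmax)%E)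
    (rho : ('rV[R]_(1 + d) -> R) -> R)
    (m : 'cV[('rV[R]_(1 + d) -> R) -> R]_d)
    (T : 'M[('rV[R]_(1 + d) -> R) -> R]_d)
    (S_distr : distributional (slab tmax) (tensor rho m T))
    (S_sym : symmetric_tensor (slab tmax) (tensor rho m T))
    (S_Div_free : Div_free (slab tmax) (tensor rho m T))
    (alpha : R) (alpha_gt0 : 0 < alpha) :
  let S_bar := tensor_bar alpha rho m T tmax in
  [/\ distributional (slab (tau alpha tmax)) S_bar,
      symmetric_tensor (slab (tau alpha tmax)) S_bar &
      Div_free (slab (tau alpha tmax)) S_bar].
Proof.
split.
- exact: tensor_bar_distributional.
- exact: tensor_bar_symmetric.
- exact: tensor_bar_Div_free.
Qed.
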